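(* Let $p\in(0,1]$ and let $W:[0,1]^2\to[0,1]$ be the step-graphon $$W(s,t)=\begin{cases}0 & \text{if } 0\le s,t<0.5,\\ p & \text{otherwise.}\end{cases}$$ Let $G_n\sim W$, and let $\vec G_n$ be the directed version of $G_n$. Then $$\lim_{n\to\infty}\mathbb{P}(\vec G_n\text{ has a Hamiltonian decomposition})=0.5.$$
   Context: A graphon is a symmetric, measurable function $W:[0,1]^2\to[0,1]$. Sampling: $G_n=(V,E)\sim W$ denotes the random undirected graph on $n$ nodes $v_1,\ldots,v_n$ obtained as follows: sample $y_1,\ldots,y_n$ independently and uniformly from $[0,1]$; then, for any two distinct nodes $v_i,v_j$, place an edge $(v_i,v_j)$ with probability $W(y_i,y_j)$, independently over pairs given the $y_i$'s. There are no self-loops in $G_n$. Directed version and Hamiltonian decomposition: for an undirected graph $G=(V,E)$, its directed version $\vec G=(V,\vec E)$ has the same node set, and each undirected edge $(v_i,v_j)\in E$ is replaced by the two directed edges $v_iv_j$ and $v_jv_i$. A Hamiltonian decomposition of $\vec G$ is a subgraph $\vec H=(V,\vec E')$ with the same node set as $\vec G$ which is a disjoint union of directed cycles (directed cycles of length two are allowed). *)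

(* Defs.v *)
From HB Require Import structures.
From mathcomp Require Import all_boot all_order all_algebra.
From mathcomp Require Import all_classical all_reals all_analysis.
From mathcomp Require Import measurable_realfun.

Set Implicit Arguments.
Unset Strict Implicit.
Unset Printing Implicit Defensive.

Import Order.TTheory GRing.Theory Num.Theory.
Import numFieldNormedType.Exports.

Local Open Scope classical_set_scope.
Local Open Scope ring_scope.

(** * Graphs *)

(* A finite simple graph: edges are unordered pairs of distinct nodes. *)
Record sgraph (V : finType) := SGraph {
  edges : {set {set V}} ;
  edges_card2 : [forall e in edges, #|e| == 2%N] }.

HB.instance Definition _ (V : finType) := [isSub for @edges V].
HB.instance Definition _ (V : finType) := [Finite of sgraph V by <:].

(* A directed graph on V is given by its arc relation. *)
Definition directed (V : finType) (G : sgraph V) : rel V :=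
  [rel x y | [set x; y]%SET \in edges G].

(* Each element of cs lists the nodes of one directed cycle in cyclic order, so
   the arcs of the cycle c are the pairs (x, next c x) with x in c. The cycles
   have length at least two, are pairwise disjoint and cover V. *)
Definition disjoint_union_of_cycles (V : finType) (H : rel V) : Prop :=
  exists cs : seq (seq V),
    [/\ forall c, c \in cs -> (1 < size c)%N,
        uniq (flatten cs),
        forall x, x \in flatten cs &
        forall x y, H x y <->
          exists c, [/\ c \in cs, x \in c & y = next c x]].

Definition has_hamiltonian_decomposition (V : finType) (D : rel V) : Prop :=
  exists H : rel V, subrel H D /\ disjoint_union_of_cycles H.

(** * Graphons *)

(* Only the restriction of a graphon to the unit square is meaningful. *)
Record graphon (R : realType) := Graphon {
  graphon_fun :> R * R -> R ;
  graphon_sym : forall s t : R, s \in `[0, 1] -> t \in `[0, 1] ->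
    graphon_fun (s, t) = graphon_fun (t, s) ;
  graphon_measurable : measurable_fun (`[0 : R, 1 : R] `*` `[0 : R, 1 : R]) graphon_fun ;
  graphon_range : forall s t : R, s \in `[0, 1] -> t \in `[0, 1] ->
    0 <= graphon_fun (s, t) <= 1 }.

Section step_graphon.
Context (R : realType) (p : R) (p_gt0 : 0 < p) (p_le1 : p <= 1).

Definition step_fun (x : R * R) : R :=
  if [&& 0 <= x.1, x.1 < 2^-1, 0 <= x.2 & x.2 < 2^-1] then 0 else p.

Lemma step_fun_sym (s t : R) : s \in `[0, 1] -> t \in `[0, 1] ->
  step_fun (s, t) = step_fun (t, s).
Proof.
by move=> _ _; rewrite /step_fun /= [in LHS]andbA [in LHS]andbC -[in LHS]andbA.
Qed.

Lemma step_fun_measurable : measurable_fun (`[0 : R, 1 : R] `*` `[0 : R, 1 : R]) step_fun.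
Proof.
apply: (@measurable_funS _ _ _ _ setT) => //.
pose A : set (R * R) := `[0 : R, 2^-1[ `*` `[0 : R, 2^-1[.
have mA : measurable A by apply: measurableX; exact: measurable_itv.
have -> : step_fun = (fun x => p * \1_(~` A) x).
  apply/funext => -[s t]; rewrite /step_fun indicE /=.
  case: ifPn => [/and4P[s0 s1 t0 t1]|nA].
    rewrite memNset ?mulr0// => -[]; split => /=.
      by rewrite in_itv/= s0.
    by rewrite in_itv/= t0.
  rewrite mem_set ?mulr1//= => -[/=]; rewrite !in_itv/= => /andP[s0 s1].
  by move=> /andP[t0 t1]; move: nA; rewrite s0 s1 t0 t1.
apply: measurable_funM => //.
by apply: measurable_indic; exact: measurableC.
Qed.

Lemma step_fun_range (s t : R) : s \in `[0, 1] -> t \in `[0, 1] ->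
  0 <= step_fun (s, t) <= 1.
Proof.
by move=> _ _; rewrite /step_fun; case: ifP => _; rewrite ?lexx ?ler01 ?(ltW p_gt0).
Qed.

Definition step_graphon : graphon R :=
  Graphon step_fun_sym step_fun_measurable step_fun_range.

End step_graphon.

(** * Sampling *)

Section sampling.
Local Open Scope ereal_scope.
Context (R : realType) (d : measure_display) (T : measurableType d).
Context (P : probability T R).

(* Taking B i = setT outside a subfamily gives the product rule for it. *)
Definition mutually_independent (n : nat) (y : 'I_n -> {RV P >-> R}) : Prop :=
  forall B : 'I_n -> set R, (forall i, measurable (B i)) ->
    P (\bigcap_i (y i @^-1` B i)) = \prod_i P (y i @^-1` B i).

Definition uniform01 (y : {RV P >-> R}) : Prop :=
  forall B : set R, measurable B ->
    distribution P y B = uniform_prob (@ltr01 R) B.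

(* The probability of drawing exactly the edges of g when each pair {i, j} is
   included independently with probability W (y i, y j). *)
Definition edge_likelihood (W : graphon R) (n : nat) (y : 'I_n -> R)
    (g : sgraph 'I_n) : R :=
  (\prod_(e : 'I_n * 'I_n | (e.1 < e.2)%N)
     if [set e.1; e.2]%SET \in edges g then W (y e.1, y e.2)
     else 1 - W (y e.1, y e.2))%R.

(* The last clause says that the conditional law of G given the sigma-algebra
   generated by y is g |-> edge_likelihood W y g; the events
   {y i in B i for all i} form a pi-system generating that sigma-algebra. *)
Definition sampled_from (W : graphon R) (n : nat) (G : T -> sgraph 'I_n) :
    Prop :=
  exists y : 'I_n -> {RV P >-> R},
    [/\ mutually_independent y,
        forall i, uniform01 (y i),
        forall g, measurable (G @^-1` [set g]) &
        forall (g : sgraph 'I_n) (B : 'I_n -> set R),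
          (forall i, measurable (B i)) ->
          P ((\bigcap_i (y i @^-1` B i)) `&` (G @^-1` [set g])) =
          \int[P]_(w in \bigcap_i (y i @^-1` B i))
             (edge_likelihood W (fun i => y i w) g)%:E].

End sampling.

(* Main.v *)
Require Import Defs.
From mathcomp Require Import all_boot all_order all_algebra.
From mathcomp Require Import all_classical all_reals all_analysis.
From mathcomp Require Import finset perm zify ring lra.

(** A Hamiltonian decomposition is the same thing as a permutation of the nodes
    along the edges ([has_hamiltonian_decompositionP]), since cycles of length
    two are allowed. Let A be the set of nodes whose latent position lies below
    1/2: it is uniformly distributed among all sets of nodes and, given A, the
    pairs inside A are never edges while the others are edges independently with
    probability p ([sampled_step_law]). The limit 1/2 is the limit probability
    that A contains at most half of the nodes.

    If A contains more than half of the nodes, no decomposition exists: the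
    permutation would map A into its smaller complement
    ([hamiltonian_weight0]).

    Otherwise a decomposition exists with probability close to 1, uniformly in A
    ([nonhamiltonian_weight_le]). The nodes are split into halves C and D with A
    contained in C, so that all pairs between C and D are possible edges. When
    the number of nodes is even, a perfect matching between C and D is a
    decomposition into cycles of length two. When it is odd, let D have one node
    d more than C. A matching of D minus d with C gives the successors of the
    nodes of D other than d, and a matching of C plus d with D which does not
    join d to itself gives the successors of the remaining nodes. In both cases
    it suffices that a random bipartite graph with independent edges, at most
    one of which is impossible, has a perfect matching. By Hall's theorem
    ([no_perfect_matching]), a graph with sides of size k without one has no edge
    between some sets S and U on the two sides with #|S| + #|U| = k + 1. The
    union bound over such pairs of sets decays exponentially in k
    ([unmatched_le]).

    It remains that A contains at most half of the nodes with probability tending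
    to 1/2. By symmetry under complementation the excess over 1/2 is half of the
    probability that A contains exactly half of them, a central binomial
    coefficient over a power of 4, which tends to 0 ([half_subsets_cvg]). *)

Import Order.TTheory GRing.Theory Num.Theory.
Import numFieldNormedType.Exports.

Set Implicit Arguments.
Unset Strict Implicit.
Unset Printing Implicit Defensive.

Local Open Scope ring_scope.

(** * Hamiltonian decompositions as permutations *)

Lemma flatten_uniq_eq (T : eqType) (cs : seq (seq T)) (c d : seq T) (x : T) :
  uniq (flatten cs) -> c \in cs -> d \in cs -> x \in c -> x \in d -> c = d.
Proof.
elim: cs => [|b cs IH] //=; rewrite cat_uniq => /and3P[_ nb ucs].
have notb e : e \in cs -> x \in e -> x \in b -> False.
  move=> ecs xe xb; move/hasPn: nb => /(_ x); rewrite xb => nb.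
  by have /nb : x \in flatten cs by apply/flattenP; exists e.
rewrite !inE => /orP[/eqP->|ccs] /orP[/eqP->|dcs] // xc xd.
- by case: (notb d).
- by case: (notb c).
- exact: IH.
Qed.

Lemma uniq_flatten_disjoint (T : eqType) (cs : seq (seq T)) :
  uniq cs -> (forall c, c \in cs -> uniq c) ->
  (forall c d x, c \in cs -> d \in cs -> x \in c -> x \in d -> c = d) ->
  uniq (flatten cs).
Proof.
elim: cs => [|b cs IH] //= /andP[bcs ucs] uc dis.
rewrite cat_uniq uc ?mem_head //= IH ?andbT //.
- apply/hasPn => x /flattenP[d dcs xd]; apply/negP => xb.
  move: bcs; rewrite (dis b d x) ?dcs ?mem_head //.
  by rewrite inE dcs orbT.
- by move=> c ccs; apply: uc; rewrite inE ccs orbT.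
- by move=> c d x ccs dcs; apply: dis; rewrite inE ?ccs ?dcs orbT.
Qed.

Lemma disjoint_union_of_cyclesP (V : finType) (H : rel V) :
  disjoint_union_of_cycles H ->
  exists s : {perm V}, forall x, H x (s x).
Proof.
move=> [cs [_ ucs covcs Hcs]].
pose c x := nth [::] cs (find (fun c => x \in c) cs).
have hasc x : has (fun c => x \in c) cs.
  by have /flattenP[d dcs xd] := covcs x; apply/hasP; exists d.
have c_cs x : c x \in cs by apply: mem_nth; rewrite -has_find.
have x_c x : x \in c x by have /(nth_find [::]) := hasc x.
have ueach d : d \in cs -> uniq d.
  elim: (cs) ucs => [|b bs IH] //=; rewrite cat_uniq => /and3P[ub _ ubs].
  by rewrite inE => /orP[/eqP->|/IH]; last exact.
have inj_s : injective (fun x => next (c x) x).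
  move=> x y /= e.
  have cxy : c x = c y.
    apply: (flatten_uniq_eq (x := next (c x) x) ucs) => //; first by rewrite mem_next.
    by rewrite e mem_next.
  have ucx : uniq (c x) by exact: ueach.
  by rewrite -(prev_next ucx x) e -cxy prev_next.
exists (perm inj_s) => x; rewrite permE; apply/Hcs.
by exists (c x); split.
Qed.

Lemma perm_disjoint_union_of_cycles (V : finType) (s : {perm V}) :
  (forall x, s x != x) ->
  disjoint_union_of_cycles [rel x y | y == s x].
Proof.
move=> nofix; have inj_s := @perm_inj V s.
have sym_s := fconnect_sym inj_s.
pose cs := [seq orbit s x | x <- enum (froots s)].
have csP c : c \in cs -> exists2 x, x \in froots s & c = orbit s x.
  by move=> /mapP[x]; rewrite mem_enum => rx ->; exists x.
have root_orbit x y : x \in froots s -> y \in orbit s x -> froot s y = x.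
  by rewrite -fconnect_orbit => /eqP rx /(fingraph.rootP sym_s) <-.
exists cs; split.
- move=> c /csP[x _ ->]; rewrite size_orbit.
  rewrite ltn_neqAle eq_sym order_gt0 andbT; apply/eqP => o1.
  by have := iter_order inj_s x; rewrite o1 /=; apply/eqP.
- apply: uniq_flatten_disjoint.
  + rewrite map_inj_in_uniq ?enum_uniq // => x y.
    rewrite !mem_enum => rx ry exy.
    have <- : froot s y = x by apply: root_orbit; rewrite // exy in_orbit.
    exact/eqP.
  + by move=> c /csP[x _ ->]; exact: orbit_uniq.
  + move=> c d x /csP[y ry ->] /csP[z rz ->] xy xz.
    by rewrite -(root_orbit y x) // (root_orbit z x).
- move=> x; apply/flattenP; exists (orbit s (froot s x)).
    by apply: map_f; rewrite mem_enum; exact: roots_root.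
  by rewrite -fconnect_orbit sym_s connect_root.
- move=> x y /=; split=> [/eqP->|[c [/csP[z rz ->] xz ->]]].
    exists (orbit s (froot s x)).
    have xo : x \in orbit s (froot s x).
      by rewrite -fconnect_orbit sym_s connect_root.
    split=> //; first by apply: map_f; rewrite mem_enum; exact: roots_root.
    by rewrite (nextE (cycle_orbit inj_s _)).
  by rewrite (nextE (cycle_orbit inj_s _)).
Qed.

(** A node and its successor on the cycle through it define a permutation, and
    conversely the arcs from each node to its image under a permutation make up
    its cycles. *)
Lemma has_hamiltonian_decompositionP (V : finType) (G : sgraph V) :
  has_hamiltonian_decomposition (directed G) <->
  exists s : {perm V}, forall x, [set x; s x]%SET \in edges G.
Proof.
split=> [[H [sHD /disjoint_union_of_cyclesP[s Hs]]]|[s Hs]].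
  by exists s => x; exact: sHD.
exists [rel x y | y == s x]; split=> [x y /eqP->|]; first exact: Hs.
apply: perm_disjoint_union_of_cycles => x; apply/eqP => sx.
have := Hs x; rewrite sx setUid => xG.
by have /forallP/(_ [set x]%SET) := edges_card2 G; rewrite xG cards1.
Qed.

(** * Perfect matchings *)

(** Hall's marriage theorem, by induction on [A] (Halmos and Vaughan). The
    matching takes values in [option Y] because [Y] may be empty when [A] is. *)
Lemma hall_marriage (X Y : finType) (A : {set X}) (E : X -> {set Y}) :
  (forall S : {set X}, S \subset A -> (#|S| <= #|\bigcup_(x in S) E x|)%N) ->
  exists f : X -> option Y, {in A &, injective f} /\
    {in A, forall x, exists2 y, y \in E x & f x = Some y}.
Proof.
have [m] := ubnP #|A|; elim: m => // m IH in A E *; rewrite ltnS => Am hallA.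
have [A0|[x0 x0A]] := set_0Vmem A.
  by exists (fun=> None); split=> [x|x]; rewrite A0 inE.
have [/exists_inP[S SA /andP[S0 /eqP tight]]|/exists_inPn slack] :=
    boolP [exists (S : {set X} | S \proper A), (S != set0) &&
      (#|\bigcup_(x in S) E x| == #|S|)].
- (* A tight proper subset is matched first, its neighbours are then removed. *)
  pose N := \bigcup_(x in S) E x.
  have [||f [injf Ef]] := IH S E.
  + exact: leq_trans (proper_card SA) Am.
  + by move=> S' S'S; apply/hallA/(fintype.subset_trans S'S)/proper_sub.
  have [||g [injg Eg]] := IH (A :\: S) (fun x => E x :\: N).
  + rewrite cardsD (setIidPr (proper_sub SA)); apply: leq_trans Am.
    by rewrite ltn_subrL !card_gt0 S0 /=; apply/set0Pn; exists x0.
  + move=> S' /subsetDP[S'A dis].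
    have /hallA : S' :|: S \subset A by rewrite subUset S'A proper_sub.
    rewrite cardsU disjoint_setI0 // cards0 subn0 bigcup_setU => le.
    have -> : \bigcup_(x in S') (E x :\: N) = (\bigcup_(x in S') E x) :\: N.
      apply/setP => y; rewrite !inE; apply/bigcupP/andP.
        move=> [x xS']; rewrite !inE => /andP[yN yE]; split=> //.
        by apply/bigcupP; exists x.
      by move=> [yN /bigcupP[x xS' yE]]; exists x; rewrite // !inE yN.
    move: le; rewrite -tight -/N cardsU cardsD.
    have := subset_leq_card (subsetIl (\bigcup_(x in S') E x) N).
    by lia.
  exists (fun x => if x \in S then f x else g x); split.
    have fg x y : x \in S -> y \in A -> y \notin S -> f x <> g y.
      move=> xS yA yS; have [z zE ->] := Ef x xS.
      have [|w] := Eg y; first by rewrite !inE yA yS.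
      rewrite !inE => /andP[wN _] -> [zw]; move/negP: wN; apply.
      by rewrite -zw; apply/bigcupP; exists x.
    move=> x y xA yA; case: ifPn => xS; case: ifPn => yS e.
    - exact: injf.
    - by case: (fg x y).
    - by case: (fg y x).
    - by apply: injg => //; rewrite !inE ?xS ?yS.
  move=> x xA; case: ifPn => xS; first exact: Ef.
  have [|y] := Eg x; first by rewrite !inE xS.
  by rewrite !inE => /andP[_ yE] ->; exists y.
- (* Every proper subset has a spare neighbour, so any arc may be chosen. *)
  have [y0 y0E] : exists y, y \in E x0.
    apply/set0Pn; rewrite -card_gt0.
    have := hallA [set x0]%SET; rewrite big_set1 cards1; apply.
    by rewrite sub1set.
  have [||g [injg Eg]] := IH (A :\ x0) (fun x => E x :\ y0).
  + by move: Am; rewrite (cardsD1 x0) x0A.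
  + move=> S SA; have [->|S0] := eqVneq S set0; first by rewrite cards0.
    have pS : S \proper A by apply: sub_proper_trans SA _; exact: properD1.
    have := slack S pS; rewrite S0 /= => neq.
    have -> : \bigcup_(x in S) (E x :\ y0) = (\bigcup_(x in S) E x) :\ y0.
      apply/setP => y; rewrite !inE; apply/bigcupP/andP.
        move=> [x xS]; rewrite !inE => /andP[yN yE]; split=> //.
        by apply/bigcupP; exists x.
      by move=> [yN /bigcupP[x xS yE]]; exists x; rewrite // !inE yN.
    have := hallA S (proper_sub pS); rewrite leq_eqVlt eq_sym (negPf neq) /=.
    rewrite (cardsD1 y0) => lt; rewrite -ltnS (leq_trans lt) //.
    by rewrite -add1n leq_add2r leq_b1.
  have gy0 x : x \in A -> x != x0 -> g x <> Some y0.
    move=> xA xx0; have [|y] := Eg x; first by rewrite !inE xA xx0.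
    by rewrite !inE => /andP[/eqP yy0 _] -> [].
  exists (fun x => if x == x0 then Some y0 else g x); split.
    move=> x y xA yA; case: eqVneq => [->|xx0]; case: eqVneq => [->|yx0] // e.
    - by case: (gy0 y).
    - by case: (gy0 x).
    - by apply: injg => //; rewrite !inE ?xx0 ?yx0.
  move=> x xA; case: eqVneq => [->|xx0]; first by exists y0.
  have [|y] := Eg x; first by rewrite !inE xx0.
  by rewrite !inE => /andP[_ yE] ->; exists y.
Qed.

(** [S] is a set violating Hall's condition and [U] consists of nodes outside its
    neighbourhood. Prescribing the total size, instead of taking all of them,
    lets the union bound depend on [#|S|] alone. *)
Lemma no_perfect_matching (I : finType) (e : rel I) :
  (forall s : {perm I}, ~~ [forall i, e i (s i)]) ->
  exists S U : {set I}, (#|S| + #|U| = #|I|.+1)%N /\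
    {in S & U, forall i j, ~~ e i j}.
Proof.
move=> nomatch.
have [/existsP[S ltS]|/existsPn hallI] :=
    boolP [exists S : {set I}, (#|\bigcup_(i in S) [set j | e i j]%SET| < #|S|)%N].
  set N := \bigcup_(i in S) _ in ltS.
  have cN : (#|N| + #|~: N| = #|I|)%N by rewrite cardsC.
  have : (#|I|.+1 - #|S| <= #|~: N|)%N by lia.
  move=> /card_geqP[u [uu su usub]].
  exists S, [set j in u]%SET; split.
    rewrite cardsE (card_uniqP uu) su subnKC //.
    by rewrite -(cardsC S); lia.
  move=> i j iS; rewrite inE => /usub; rewrite inE => jN.
  by apply: contra jN => eij; apply/bigcupP; exists i; rewrite ?inE.
have [|f [injf Ef]] := @hall_marriage I I setT (fun i => [set j | e i j]%SET).
  by move=> S _; rewrite leqNgt.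
pose h i := odflt i (f i).
have fh i : f i = Some (h i) by have [//|y _ fy] := Ef i; rewrite /h fy.
have injh : injective h by move=> i j ij; apply: injf; rewrite // !fh ij.
case/negP: (nomatch (perm injh)); apply/forallP => i; rewrite permE.
by have [//|y] := Ef i; rewrite inE fh => ? [->].
Qed.

(** * The union bound over pairs of sets without edges *)

Section union_bound.
Context (R : realDomainType) (q : R).
Hypothesis q01 : 0 <= q <= 1.

(** The bound obtained below for the probability that a random bipartite graph
    with sides of size [k], whose pairs are absent with probability at most [q],
    has no perfect matching. *)
Definition unmatched_bound (k : nat) : R :=
  (k.+1 * k ^ 2)%:R * q ^+ (k.-1)./2.

Lemma bin_le_expn (n j : nat) : ('C(n, j) <= n ^ j)%N.
Proof.
apply: (@leq_trans (n ^_ j)); first by rewrite -bin_ffact leq_pmulr // fact_gt0.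
elim: j n => // j IH [//|n]; rewrite ffactSS expnS leq_mul //.
by apply: leq_trans (IH n) _; case: (j) => // i; rewrite leq_exp2r.
Qed.

(** There are at most [k ^ (2 * j)] pairs of sets whose smaller part has size
    [j], and at least [j * (k.-1)./2] pairs of nodes have to be absent. So the
    contribution is at most the [j]-th power of the right-hand side, hence at
    most that side as it does not exceed 1. *)
Lemma union_term_bound (k j : nat) : (0 < j)%N -> (j.*2 <= k.+1)%N ->
  (k ^ 2)%:R * q ^+ (k.-1)./2 <= 1 ->
  ('C(k, j) * 'C(k, j.-1))%:R * q ^+ (j * (k.+1 - j) - 1) <=
  (k ^ 2)%:R * q ^+ (k.-1)./2.
Proof.
have [q0 q1] := andP q01.
move=> j0 jk le1; set b := _ * _ in le1 *.
have b0 : 0 <= b by rewrite mulr_ge0 ?exprn_ge0.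
apply: (@le_trans _ _ (b ^+ j)); last first.
  by case: j j0 {jk} => // j _; rewrite exprS ler_piMr // exprn_ile1.
rewrite /b exprMn -natrX -expnM -exprM; apply: ler_pM => //.
- by rewrite exprn_ge0.
- rewrite ler_nat mul2n -addnn expnD leq_mul ?bin_le_expn //.
  apply: leq_trans (bin_le_expn _ _) _; apply: leq_pexp2l; lia.
- apply: ler_wiXn2l => //; nia.
Qed.

(** The exponent is the number of pairs between the two sets, less the one
    impossible pair that they may contain. *)
Lemma union_bound_le (k : nat) : (k ^ 2)%:R * q ^+ (k.-1)./2 <= 1 ->
  \sum_(x : {set 'I_k} * {set 'I_k} | (#|x.1| + #|x.2| == k.+1)%N)
    q ^+ (#|x.1| * #|x.2| - 1) <= unmatched_bound k.
Proof.
move=> le1; have [q0 q1] := andP q01.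
rewrite (partition_big
  (fun x : {set 'I_k} * {set 'I_k} => inord #|x.1| : 'I_k.+1) xpredT) //=.
have -> : unmatched_bound k = \sum_(s < k.+1) (k ^ 2)%:R * q ^+ (k.-1)./2.
  by rewrite sumr_const card_ord -[RHS]mulr_natl mulrA -natrM.
have cI (S : {set 'I_k}) : (#|S| <= k)%N by rewrite -[leqRHS]card_ord max_card.
apply: ler_sum => s _.
apply: (@le_trans _ _ (\sum_(x in setX [set S : {set 'I_k} | #|S| == s]
    [set U : {set 'I_k} | #|U| == k.+1 - s]%N) q ^+ (s * (k.+1 - s) - 1))).
  rewrite le_eqVlt; apply/orP; left; apply/eqP; apply: eq_big => [[S U]|[S U]].
    rewrite !inE /= -val_eqE /= inordK ?ltnS //.
    by have := cI S; have := cI U; have := ltn_ord s; lia.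
  rewrite /= -val_eqE /= inordK ?ltnS // => /andP[/eqP SU /eqP <-].
  by rewrite -SU addKn.
rewrite sumr_const cardsX !card_draws card_ord -[leLHS]mulr_natl.
have [s0|s0] := posnP s.
  by rewrite s0 subn0 (@bin_small k k.+1) // muln0 mul0r mulr_ge0 ?exprn_ge0.
have sk := ltn_ord s; have [sle|slt] := leqP s.*2 k.+1.
  have -> : 'C(k, k.+1 - s) = 'C(k, s.-1) by rewrite -bin_sub; [congr 'C(_, _)|]; lia.
  exact: union_term_bound.
(* The larger part comes first: exchange the roles of the two sides. *)
pose t := (k.+1 - s)%N.
have -> : 'C(k, s) = 'C(k, t.-1) by rewrite -bin_sub; [congr 'C(_, _)|]; lia.
rewrite -/t mulnC [(s * t)%N]mulnC; have -> : s = (k.+1 - t)%N :> nat by lia.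
by apply: union_term_bound => //; rewrite /t; lia.
Qed.

End union_bound.

(** * Graphs with independent edges *)

Section independent_edges.
Context (R : realDomainType) (V : finType).
Implicit Types (w : {set V} -> R) (g : sgraph V) (F : {set {set V}}).

(** The likelihood of [g] when each set [e] is an edge with probability [w e],
    independently. The product runs over all sets of nodes: as [w] vanishes
    away from the pairs, the other factors are equal to 1. *)
Definition graph_weight w g : R :=
  \prod_(e : {set V}) (if e \in edges g then w e else 1 - w e).

Lemma graph_weight_ge0 w g : (forall e, 0 <= w e <= 1) -> 0 <= graph_weight w g.
Proof.
move=> w01; apply: prodr_ge0 => e _; have /andP[w0 w1] := w01 e.
by case: ifP; rewrite ?subr_ge0.
Qed.

(** Expanding the product of the factors [w e + (1 - w e)], with [w e] replaced
    by 0 on [F], yields one term for each graph without edges in [F]. *)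
Lemma sum_graph_weight_disjoint w F :
  (forall e : {set V}, #|e| != 2%N -> w e = 0) ->
  \sum_(g | [disjoint F & edges g]) graph_weight w g = \prod_(e in F) (1 - w e).
Proof.
move=> w0.
transitivity (\prod_(e : {set V}) ((if e \in F then 0 else w e) + (1 - w e))).
  rewrite bigA_distr.
  transitivity (\sum_(J : {set {set V}} |
      [disjoint F & J] && [forall e in J, #|e| == 2%N])
      \prod_(e : {set V}) (if e \in J then w e else 1 - w e)).
    rewrite (reindex_omap (@edges V) insub) /=; last first.
      by move=> J /andP[_ J2]; rewrite insubT.
    apply: eq_big => [g|g _] //.
    rewrite edges_card2 andbT; case: insubP => [u _ /val_inj ->|].
      by rewrite eqxx andbT.
    by rewrite edges_card2.
  rewrite big_mkcond; apply: eq_bigr => J _; case: ifPn => [/andP[dis J2]|].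
    apply: eq_bigr => e _; case: ifPn => // eJ.
    by rewrite (disjointFl dis eJ).
  rewrite negb_and => /orP[/pred0Pn[e /= /andP[eF eJ]]|/forall_inPn[e eJ e2]].
    by rewrite (bigD1 e) //= eJ eF mul0r.
  by rewrite (bigD1 e) //= eJ w0 // if_same mul0r.
rewrite [RHS]big_mkcond; apply: eq_bigr => e _; case: ifP => _.
  by rewrite add0r.
by rewrite addrC subrK.
Qed.

Lemma sum_graph_weight w : (forall e : {set V}, #|e| != 2%N -> w e = 0) ->
  \sum_g graph_weight w g = 1.
Proof.
move=> w0; have := sum_graph_weight_disjoint set0 w0; rewrite big_set0 => <-.
by apply: eq_bigl => g; rewrite -setI_eq0 set0I eqxx.
Qed.

End independent_edges.

(** * Matchings in graphs with independent edges *)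

Section matching.
Context (R : realDomainType) (V : finType) (w : {set V} -> R) (q : R).
Hypothesis (w0 : forall e : {set V}, #|e| != 2%N -> w e = 0).
Hypothesis (w01 : forall e, 0 <= w e <= 1).
Context (k : nat) (l r : 'I_k -> V).
Hypothesis (l_inj : injective l) (r_inj : injective r).
Hypothesis (one_loop : forall i j i' j', l i = r j -> l i' = r j' -> i = i' /\ j = j').
Hypothesis (q_ge : forall i j, l i != r j -> 1 - w [set l i; r j] <= q).
Hypothesis (q01 : 0 <= q <= 1).

(* The images of [l] and [r] may share one node, which gives no pair. *)
Let cross (S U : {set 'I_k}) : {set {set V}} :=
  [set [set l x.1; r x.2] | x in [set x in setX S U | l x.1 != r x.2]].

(** Two different pairs of indices could only give the same unordered pair of
    nodes by a swap, with [l i = r j'] and [l i' = r j]; by [one_loop] these are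
    the same coincidence, so that [l i = r j], which is excluded. At most one
    pair of indices is lost to that exclusion. *)
Lemma card_cross (S U : {set 'I_k}) : (#|S| * #|U| - 1 <= #|cross S U|)%N.
Proof.
rewrite card_in_imset => [|[i j] [i' j']]; last first.
  rewrite !inE /= => /andP[_ lr] /andP[_ lr'] e.
  have := set21 (l i) (r j); rewrite [in X in X -> _]e => /set2P[ll|lr2].
    have := set22 (l i) (r j); rewrite [in X in X -> _]e => /set2P[rl|/r_inj ->].
      by move: lr; rewrite ll rl eqxx.
    by rewrite (l_inj ll).
  have := set21 (l i') (r j'); rewrite -[in X in X -> _]e => /set2P[ll|lr3].
    by move: lr'; rewrite ll lr2 eqxx.
  have [_ jj] := one_loop lr2 lr3.
  by move: lr; rewrite lr2 jj eqxx.
rewrite -cardsX -(cardsID [set x | l x.1 != r x.2] (setX S U)).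
rewrite leq_subLR addnC -setIdE; apply: leq_add => //.
apply/card_le1_eqP => -[i j] [i' j']; rewrite !inE /= !negbK.
move=> /andP[/eqP lr _] /andP[/eqP lr' _].
by have [-> ->] := one_loop lr lr'.
Qed.

Let matched (g : sgraph V) :=
  [exists s : {perm 'I_k}, forall i, [set l i; r (s i)] \in edges g].

Lemma unmatched_union_bound :
  \sum_(g | ~~ matched g) graph_weight w g <=
  \sum_(x : {set 'I_k} * {set 'I_k} | (#|x.1| + #|x.2| == k.+1)%N)
    q ^+ (#|x.1| * #|x.2| - 1).
Proof.
have [q0 q1] := andP q01.
pose P (x : {set 'I_k} * {set 'I_k}) := (#|x.1| + #|x.2| == k.+1)%N.
apply: (@le_trans _ _ (\sum_(g | ~~ matched g)
    \sum_(x | P x && [disjoint cross x.1 x.2 & edges g]) graph_weight w g)).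
  apply: ler_sum => g nm.
  have [|S [U [cSU noSU]]] :=
      @no_perfect_matching _ [rel i j | [set l i; r j] \in edges g].
    by move/existsPn: nm.
  rewrite (bigD1 (S, U)) /=.
    rewrite lerDl sumr_ge0 // => *; exact: graph_weight_ge0.
  rewrite /P /= cSU card_ord eqxx /=; apply/pred0P => e /=; apply/negP.
  move=> /andP[/imsetP[[i j]]]; rewrite !inE /= => /andP[/andP[iS jU] _ ->].
  by apply/negP/noSU.
rewrite (exchange_big_dep P) /=; last by move=> g x _ /andP[].
apply: ler_sum => -[S U] /= cSU.
apply: (@le_trans _ _ (\sum_(g | [disjoint cross S U & edges g]) graph_weight w g)).
  rewrite [leRHS](bigID matched) /= addrC.
  under eq_bigl => g do rewrite cSU andTb andbC.
  rewrite lerDl sumr_ge0 // => *; exact: graph_weight_ge0.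
rewrite sum_graph_weight_disjoint //.
apply: (@le_trans _ _ (q ^+ #|cross S U|)); last first.
  by apply: ler_wiXn2l => //; exact: card_cross.
rewrite -prodr_const; apply: ler_prod => e /imsetP[[i j]].
rewrite !inE => /andP[_ lr] ->; rewrite q_ge //.
by rewrite subr_ge0; have /andP[_ ->] := w01 [set l i; r j].
Qed.

Lemma unmatched_le :
  \sum_(g | ~~ matched g) graph_weight w g <= unmatched_bound q k.
Proof.
have [q0 q1] := andP q01.
have [le1|gt1] := leP ((k ^ 2)%:R * q ^+ (k.-1)./2) 1.
  by apply: le_trans unmatched_union_bound _; exact: union_bound_le.
(* The bound exceeds the total weight. *)
apply: (@le_trans _ _ 1).
  rewrite -(sum_graph_weight w0) [leRHS](bigID matched) /= addrC.
  by rewrite lerDl sumr_ge0 // => *; exact: graph_weight_ge0.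
apply: le_trans (ltW gt1) _; rewrite /unmatched_bound natrM -mulrA.
by rewrite ler_peMl ?ler1n // mulr_ge0 ?exprn_ge0.
Qed.

End matching.

(** * Hamiltonicity given the latent halves *)

Definition hamiltonian (V : finType) (g : sgraph V) :=
  [exists s : {perm V}, forall x, [set x; s x] \in edges g].

(** The first matching, read from [l] to [r], and the second, read from [r'] to
    [l'], make up a permutation: [l] with [r'], and [r] with [l'], exhaust the
    nodes. *)
Lemma hamiltonian_glue (V : finType) (g : sgraph V) (k m : nat)
    (l r : 'I_k -> V) (l' r' : 'I_m -> V) (s : {perm 'I_k}) (s' : {perm 'I_m}) :
  injective l -> injective r -> injective l' -> injective r' ->
  (forall i j, l i != r' j) -> (forall i j, r i != l' j) ->
  #|V| = (k + m)%N ->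
  (forall i, [set l i; r (s i)] \in edges g) ->
  (forall i, [set l' i; r' (s' i)] \in edges g) ->
  hamiltonian g.
Proof.
move=> l_inj r_inj l'_inj r'_inj lr' rl' cV ls ls'.
pose src (x : 'I_k + 'I_m) := match x with inl i => l i | inr j => r' j end.
pose tgt (x : 'I_k + 'I_m) :=
  match x with inl i => r (s i) | inr j => l' ((s'^-1)%g j) end.
have src_inj : injective src.
  move=> [i|i] [j|j] /= e.
  - by rewrite (l_inj _ _ e).
  - by have := lr' i j; rewrite e eqxx.
  - by have := lr' j i; rewrite e eqxx.
  - by rewrite (r'_inj _ _ e).
have tgt_inj : injective tgt.
  move=> [i|i] [j|j] /= e.
  - by rewrite (perm_inj (r_inj _ _ e)).
  - by have := rl' (s i) ((s'^-1)%g j); rewrite e eqxx.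
  - by have := rl' (s j) ((s'^-1)%g i); rewrite -e eqxx.
  - by rewrite (perm_inj (l'_inj _ _ e)).
have [inv srcK invK] : bijective src.
  by apply: inj_card_bij => //; rewrite card_sum !card_ord cV.
have f_inj : injective (tgt \o inv).
  exact: inj_comp tgt_inj (can_inj invK).
apply/existsP; exists (perm f_inj); apply/forallP => x; rewrite permE /=.
rewrite -{1}(invK x); case: (inv x) => [i|j] //=.
by rewrite setUC -{2}(permKV s' j).
Qed.

Lemma enum_set_first (V : finType) (A : {set V}) :
  exists v : 'I_#|V| -> V, injective v /\ forall i, v i \in A -> (i < #|A|)%N.
Proof.
pose s := enum A ++ enum (~: A).
have us : uniq s.
  rewrite cat_uniq !enum_uniq andbT /=; apply/hasPn => x.
  by rewrite !mem_enum inE.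
have ss : size s = #|V| by rewrite size_cat -!cardE cardsC.
exists (fun i => nth (enum_val i) s i); split=> [i j|i].
  rewrite (set_nth_default (enum_val j)) ?ss // => /eqP.
  by rewrite nth_uniq ?ss // => /eqP/val_inj.
rewrite ltnNge; apply: contraL => Ai; rewrite nth_cat -cardE.
rewrite ltnNge Ai /=; set x := nth _ _ _.
have : x \in enum (~: A).
  by apply: mem_nth; rewrite -cardE ltn_subLR // cardsC.
by rewrite mem_enum inE.
Qed.

Section hamiltonian.
Context (R : realDomainType) (p : R) (V : finType) (A : {set V}).
Hypothesis (p01 : 0 <= p <= 1).

Definition step_weight (e : {set V}) : R :=
  if (#|e| == 2%N) && ~~ (e \subset A) then p else 0.

Lemma step_weight_ge0_le1 e : 0 <= step_weight e <= 1.
Proof. by rewrite /step_weight; case: ifP => _ //; rewrite lexx ler01. Qed.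

Lemma step_weight_card2 (e : {set V}) : #|e| != 2%N -> step_weight e = 0.
Proof. by rewrite /step_weight => /negPf ->. Qed.

(** A permutation cannot map [A] into its smaller complement, and a graph with
    an edge inside [A] has likelihood 0. *)
Lemma hamiltonian_weight0 : (#|V| < #|A|.*2)%N ->
  \sum_(g | hamiltonian g) graph_weight step_weight g = 0.
Proof.
move=> VA; apply: big1 => g /existsP[s /forallP sg].
have [/exists_inP[x xA sxA]|/exists_inPn sA] := boolP [exists x in A, s x \in A].
  rewrite /graph_weight (bigD1 [set x; s x]) //= sg /step_weight.
  by rewrite subUset !sub1set xA sxA andbF mul0r.
have : (#|s @: A| <= #|~: A|)%N.
  by apply/subset_leq_card/fintype.subsetP => _ /imsetP[x xA ->]; rewrite inE sA.
rewrite card_imset; last exact: perm_inj.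
by rewrite leqNgt -(ltn_add2l #|A|) cardsC addnn VA.
Qed.

(** List the nodes beginning with those of [A]. The first half covers [A], so the
    pairs that meet the second half are all edges with probability [p]. The
    maps [l1], [r1] list the first [m] nodes and the next [m] ones; [l2], [r2]
    do the same, except that when the number of nodes is odd the last node is
    appended to both. A graph in which both pairs of sides can be matched is
    Hamiltonian by [hamiltonian_glue]. *)
Lemma nonhamiltonian_weight_le (m : nat) :
  m = #|V|./2 -> (#|A|.*2 <= #|V|)%N ->
  \sum_(g | ~~ hamiltonian g) graph_weight step_weight g <=
  unmatched_bound (1 - p) (#|V| - m) + unmatched_bound (1 - p) m.
Proof.
move=> mE AV; have [v [v_inj vA]] := enum_set_first A.
pose k := (#|V| - m)%N.
have km : (m <= k <= m.+1)%N by rewrite /k; lia.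
have kV : (k + m = #|V|)%N by rewrite /k; lia.
have l1V (i : 'I_m) : (i < #|V|)%N by have := ltn_ord i; lia.
have r1V (i : 'I_m) : (m + i < #|V|)%N by have := ltn_ord i; lia.
have l2V (i : 'I_k) : ((if i < m then i : nat else m.*2) < #|V|)%N.
  by have := ltn_ord i; case: ifP; lia.
have r2V (i : 'I_k) : (m + i < #|V|)%N by have := ltn_ord i; lia.
pose l1 i := v (Ordinal (l1V i)); pose r1 i := v (Ordinal (r1V i)).
pose l2 i := v (Ordinal (l2V i)); pose r2 i := v (Ordinal (r2V i)).
have vE (a b : nat) (ha : (a < #|V|)%N) (hb : (b < #|V|)%N) :
    v (Ordinal ha) = v (Ordinal hb) -> a = b by move=> /v_inj[].
have l1_inj : injective l1 by move=> i j /vE ?; exact: val_inj.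
have r1_inj : injective r1 by move=> i j /vE ?; apply: val_inj => /=; lia.
have r2_inj : injective r2 by move=> i j /vE ?; apply: val_inj => /=; lia.
have l2_inj : injective l2.
  move=> i j /vE e; apply: val_inj => /=; move: e (ltn_ord i) (ltn_ord j).
  by case: ifP; case: ifP; lia.
have q01 : 0 <= 1 - p <= 1.
  by have /andP[p0 p1] := p01; rewrite subr_ge0 p1 lerBlDr lerDl.
have qge (x y : V) : y \notin A -> x != y -> 1 - step_weight [set x; y] <= 1 - p.
  move=> yA xy; rewrite /step_weight cards2 xy /=.
  by rewrite subUset !sub1set (negPf yA) andbF.
have notA (i : nat) (hi : (i < #|V|)%N) : (m <= i)%N -> v (Ordinal hi) \notin A.
  by move=> mi; apply/negP => /vA /=; lia.
have le1 := @unmatched_le R V step_weight (1 - p) step_weight_card2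
  step_weight_ge0_le1 m l1 r1 l1_inj r1_inj _ _ q01.
have le2 := @unmatched_le R V step_weight (1 - p) step_weight_card2
  step_weight_ge0_le1 k l2 r2 l2_inj r2_inj _ _ q01.
apply: le_trans (lerD (le2 _ _) (le1 _ _)); last first.
- by move=> i j; apply: qge; apply: notA; lia.
- by move=> i j i' j' /vE; have := ltn_ord i; lia.
- by move=> i j; apply: qge; apply: notA; lia.
- move=> i j i' j' /vE e /vE e'.
  have := ltn_ord i; have := ltn_ord i'; have := ltn_ord j; have := ltn_ord j'.
  by move: e e'; case: ifP; case: ifP => ? ? ? ? ? ? ? ?; split; apply: val_inj => /=; lia.
pose M2 (g : sgraph V) :=
  [exists s : {perm 'I_k}, forall i, [set l2 i; r2 (s i)] \in edges g].
pose M1 (g : sgraph V) :=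
  [exists s : {perm 'I_m}, forall i, [set l1 i; r1 (s i)] \in edges g].
have gw0 g : 0 <= graph_weight step_weight g.
  exact/graph_weight_ge0/step_weight_ge0_le1.
rewrite (bigID M2) /= addrC; apply: lerD.
  rewrite [leRHS](bigID (@hamiltonian V)) /= addrC.
  under eq_bigl => g do rewrite andbC.
  by rewrite lerDl sumr_ge0.
rewrite [leRHS](bigID (fun g => ~~ hamiltonian g && M2 g)) /=.
rewrite [leLHS](eq_bigl (fun g => ~~ M1 g && (~~ hamiltonian g && M2 g))).
  by rewrite lerDl sumr_ge0.
move=> g; case: (boolP (M1 g)); rewrite ?andbT //=.
move=> /existsP[s1 /forallP s1g]; apply/negP => /andP[/negP nh].
move=> /existsP[s2 /forallP s2g]; apply: nh.
apply: (hamiltonian_glue (l := l2) (r := r2) (l' := l1) (r' := r1)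
  (s := s2) (s' := s1)) => //.
- move=> i j; apply/eqP => /vE; have := ltn_ord i; have := ltn_ord j.
  by case: ifP; lia.
- by move=> i j; apply/eqP => /vE; have := ltn_ord j; lia.
Qed.

End hamiltonian.

(** * Sets of at most half of the nodes *)

(** The ratio of two consecutive central binomial coefficients is
    [2 * (2 * m + 1) / (m + 1)], and [(2 * m + 1) * (2 * m + 3)] is less than
    [4 * (m + 1) ^ 2]. *)
Lemma central_bin_le (m : nat) : ('C(m.*2, m) ^ 2 * m.*2.+1 <= 16 ^ m)%N.
Proof.
elim: m => // m IH; rewrite doubleS.
have rec : (m.+1 * 'C(m.*2.+2, m.+1) = 2 * m.*2.+1 * 'C(m.*2, m))%N.
  have e1 : (m.+1 * 'C(m.*2.+1, m.+1) = m.*2.+1 * 'C(m.*2, m))%N by rewrite -mul_bin_diag.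
  have e2 : 'C(m.*2.+1, m.+1) = 'C(m.*2.+1, m).
    by rewrite -bin_sub; [congr 'C(_, _)|]; lia.
  by rewrite binS -e2 mulnDr e1; lia.
rewrite -(leq_pmul2l (_ : 0 < m.+1 ^ 2)%N) ?expn_gt0 // mulnA -expnMn rec.
have -> : ((2 * m.*2.+1 * 'C(m.*2, m)) ^ 2 * m.*2.+3 =
    'C(m.*2, m) ^ 2 * m.*2.+1 * (4 * m.*2.+1 * m.*2.+3))%N.
  by rewrite !expnMn; lia.
rewrite [leqRHS]mulnC [in leqRHS]expnSr -[leqRHS]mulnA; apply: leq_mul => //.
by rewrite -mulnn; nia.
Qed.

Section half.
Variable R : realType.

Definition small_subsets (n : nat) : {set {set 'I_n}} :=
  [set A : {set 'I_n} | (#|A|.*2 <= n)%N].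

(** Complementation exchanges the sets of at most half and those of at least half
    of the nodes; these two families cover everything and overlap in the sets of
    exactly half. *)
Lemma half_subsets (n : nat) :
  (2 * #|small_subsets n| =
   2 ^ n + #|[set A : {set 'I_n} | #|A|.*2 == n]|)%N.
Proof.
rewrite /small_subsets; set L := [set A : {set 'I_n} | _]; set M := [set A : {set 'I_n} | _].
pose U := [set A : {set 'I_n} | (n <= #|A|.*2)%N].
have cUL : #|U| = #|L|.
  rewrite -(card_imset (mem L) (@setC_inj 'I_n)); congr #|pred_of_set _|.
  apply/setP => A; rewrite !inE; apply/idP/imsetP => [nA|[B + ->]].
    exists (~: A); last by rewrite setCK.
    by rewrite inE; have := cardsC A; rewrite card_ord; lia.
  by rewrite inE; have := cardsC B; rewrite card_ord; lia.
have <- : L :&: U = M by apply/setP => A; rewrite !inE eqn_leq.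
rewrite mul2n -addnn -{2}cUL -cardsUI; congr (_ + _)%N.
have -> : L :|: U = setT by apply/setP => A; rewrite !inE; exact: leq_total.
by rewrite -powersetT card_powerset cardsT card_ord.
Qed.

(** The difference is half of the proportion of sets of exactly [n / 2] nodes.
    It is squared because [central_bin_le] bounds the square. *)
Lemma half_subsets_dist (n : nat) :
  (#|small_subsets n|%:R / 2 ^+ n - 2^-1 : R) ^+ 2
  <= n.+1%:R^-1.
Proof.
set c := #|_|; set b := #|[set A : {set 'I_n} | #|A|.*2 == n]|.
have cb : (2 * c%:R = 2 ^+ n + b%:R :> R).
  by rewrite -natrM half_subsets natrD natrX.
have pow0 : (0 : R) < 2 ^+ n by rewrite exprn_gt0.
have -> : c%:R / 2 ^+ n - 2^-1 = b%:R / 2 ^+ n / 2 :> R.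
  by have -> : c%:R = (2 ^+ n + b%:R) / 2 :> R by [rewrite -cb; field]; field; rewrite gt_eqF.
have bn : (b ^ 2 * n.+1 <= 4 ^ n)%N.
  rewrite /b -(odd_double_half n); case: (odd n) => /=.
    rewrite (_ : [set _ | _] = set0) ?cards0 //.
    by apply/setP => A; rewrite !inE; apply/negP => /eqP; lia.
  rewrite add0n; set m := n./2.
  rewrite (_ : [set _ | _] = [set A : {set 'I_m.*2} | #|A| == m]).
    rewrite card_draws card_ord (leq_trans (central_bin_le m)) //.
    by rewrite -mul2n expnM.
  by apply/setP => A; rewrite !inE (inj_eq double_inj).
have bnR : b%:R ^+ 2 * n.+1%:R <= (2 ^+ n) ^+ 2 :> R.
  by rewrite -exprM mulnC exprM -natrX -natrX -natrM -natrX ler_nat.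
have ratio1 : b%:R ^+ 2 * n.+1%:R / (2 ^+ n) ^+ 2 <= 1 :> R.
  by rewrite ler_pdivrMr ?mul1r // exprn_gt0.
have ratio0 : 0 <= b%:R ^+ 2 * n.+1%:R / (2 ^+ n) ^+ 2 :> R.
  by rewrite divr_ge0 ?mulr_ge0 ?exprn_ge0 // ltW.
rewrite -[leRHS]mul1r ler_pdivlMr ?ltr0n //.
have -> : (b%:R / 2 ^+ n / 2) ^+ 2 * n.+1%:R =
    b%:R ^+ 2 * n.+1%:R / (2 ^+ n) ^+ 2 / 4 :> R.
  by field; rewrite gt_eqF.
by lra.
Qed.

Lemma half_subsets_cvg :
  ((fun n => #|small_subsets n|%:R / 2 ^+ n : R) @ \oo --> (2^-1 : R))%classic.
Proof.
apply/cvgrPdist_lt => e e0.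
have e20 : 0 < e ^+ 2 by rewrite exprn_gt0.
have /cvgr0Pnorm_lt/(_ _ e20) := @cvg_harmonic R.
apply: filterS => n; rewrite /harmonic ger0_norm ?invr_ge0 // => ne.
rewrite distrC -(ltr_pXn2r (_ : 0 < 2)%N) ?nnegrE ?(ltW e0) // real_normK ?num_real //.
exact: le_lt_trans (half_subsets_dist n) ne.
Qed.

(** Exponential decay, through [1 - p <= expR (- p)] and the fourth power of
    [1 + x <= expR x], beats the cubic factor by one order. *)
Lemma unmatched_bound_le (p : R) (k : nat) : 0 < p -> p <= 1 ->
  unmatched_bound (1 - p) k <= 81 * (4 / p) ^+ 4 / k.+1%:R.
Proof.
move=> p0 p1; rewrite /unmatched_bound; set N := (k.-1)./2.
have kN : (k.+1 <= 3 * N.+1)%N by rewrite /N; lia.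
have decay : (1 - p) ^+ N <= (4 / p / N.+1%:R) ^+ 4.
  apply: (@le_trans _ _ (expR (- p) ^+ N)).
    by apply: lerXn2r; rewrite ?nnegrE ?subr_ge0 ?expR_ge0 ?expR_ge1Dx.
  have -> : expR (- p) ^+ N = (expR (p / 4 * N%:R))^-1 ^+ 4.
    by rewrite -expRN -!expRM_natl; congr expR; field.
  apply: lerXn2r; rewrite ?nnegrE ?invr_ge0 ?expR_ge0 //.
    by rewrite !divr_ge0 ?ltW.
  have -> : 4 / p / N.+1%:R = (p / 4 * N.+1%:R)^-1.
    by field; rewrite nat1r pnatr_eq0 /= gt_eqF.
  rewrite lef_pV2 ?posrE ?expR_gt0 ?mulr_gt0 ?invr_gt0 //.
  apply: le_trans (expR_ge1Dx _).
  by rewrite -[N.+1%:R]natr1 mulrDr mulr1 addrC lerD2r; lra.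
have k3 : ((k.+1 * k ^ 2)%:R <= (3 * N.+1%:R) ^+ 3 :> R).
  rewrite -natrM -natrX ler_nat [leqRHS]expnS leq_mul //.
  by rewrite leq_exp2r // (leq_trans _ kN).
apply: (@le_trans _ _ ((3 * N.+1%:R) ^+ 3 * (4 / p / N.+1%:R) ^+ 4)).
  by apply: ler_pM; rewrite // exprn_ge0 // subr_ge0.
have -> : (3 * N.+1%:R) ^+ 3 * (4 / p / N.+1%:R) ^+ 4 =
    81 * (4 / p) ^+ 4 / (3 * N.+1%:R) :> R.
  by field; rewrite nat1r pnatr_eq0 /= gt_eqF.
rewrite ler_pM2l ?mulr_gt0 ?exprn_gt0 ?invr_gt0 //.
by rewrite lef_pV2 ?posrE ?mulr_gt0 // -natrM ler_nat.
Qed.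

End half.

(** * The law of the sampled graph *)

Lemma prod_pairs (R : comPzRingType) (n : nat) (h : {set 'I_n} -> R) :
  (forall e : {set 'I_n}, #|e| != 2%N -> h e = 1) ->
  \prod_(e : 'I_n * 'I_n | (e.1 < e.2)%N) h [set e.1; e.2] = \prod_e h e.
Proof.
move=> h1; rewrite [RHS](bigID (fun e : {set 'I_n} => #|e| == 2%N)) /=.
rewrite [X in _ * X]big1 // mulr1.
pose D := [set e : 'I_n * 'I_n | (e.1 < e.2)%N].
pose pair (e : 'I_n * 'I_n) := [set e.1; e.2].
have pair_inj : {in D &, injective pair}.
  move=> [i j] [i' j']; rewrite !inE /pair /= => ij ij' e.
  have /set2P[ei|ei] : i \in [set i'; j'] by rewrite -e set21.
    have /set2P[ej|->] : j \in [set i'; j'] by rewrite -e set22.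
      by move: ij; rewrite ei ej ltnn.
    by rewrite ei.
  have /set2P[ej|ej] : j \in [set i'; j'] by rewrite -e set22.
    by move: ij ij'; rewrite ei ej; lia.
  by move: ij; rewrite ei ej ltnn.
have pairD : pair @: D = [set e : {set 'I_n} | #|e| == 2%N].
  apply/setP => e; rewrite inE; apply/imsetP/cards2P => [[[i j]]|[i [j [ij ->]]]].
    by rewrite inE /= => ij ->; exists i, j; rewrite neq_ltn ij.
  move: ij; rewrite neq_ltn => /orP[ij|ji].
    by exists (i, j); rewrite ?inE.
  by exists (j, i); rewrite ?inE // /pair setUC.
transitivity (\prod_(e in D) h (pair e)); first by apply: eq_bigl => e; rewrite inE.
by rewrite -(big_imset h pair_inj) pairD; apply: eq_bigl => e; rewrite inE.
Qed.

Section step_likelihood.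
Context (R : realType) (p : R) (p_gt0 : 0 < p) (p_le1 : p <= 1).

Lemma edge_likelihood_step (n : nat) (y : 'I_n -> R) (A : {set 'I_n})
    (g : sgraph 'I_n) :
  (forall i, (i \in A) = (0 <= y i < 2^-1)) ->
  edge_likelihood (step_graphon p_gt0 p_le1) y g = graph_weight (step_weight p A) g.
Proof.
move=> Ay; rewrite /graph_weight -prod_pairs => [|e e2]; last first.
  rewrite step_weight_card2 // subr0 ifN //; apply: contra e2 => eg.
  by have /forall_inP/(_ _ eg) := edges_card2 g.
apply: eq_bigr => -[i j] /= ij; rewrite /step_weight /step_fun /= cards2.
rewrite neq_ltn ij /= subUset !sub1set !Ay -andbA.
by case: ifP => /=; case: ifP.
Qed.

End step_likelihood.

Local Open Scope classical_set_scope.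
Local Open Scope ring_scope.

Section law.
Context (R : realType) (p : R) (p_gt0 : 0 < p) (p_le1 : p <= 1).
Context (d : measure_display) (T : measurableType d) (P : probability T R).

Lemma measure_finite_union (mu : {measure set T -> \bar R}) (I : finType)
    (Q : pred I) (F : I -> set T) :
  (forall i, Q i -> measurable (F i)) -> classical_sets.trivIset [set` Q] F ->
  mu (\bigcup_(i in [set` Q]) F i) = (\sum_(i | Q i) mu (F i))%E.
Proof.
move=> mF tF; rewrite measure_fin_bigcup; [|exact: finite_finset|exact: tF|exact: mF].
by rewrite -(@bigfs _ _ _ _ (index_enum I)) ?index_enum_uniq // => i _; rewrite mem_index_enum.
Qed.

(** The right half is taken in the whole line, so that the two halves cover all
    values of the latent positions, null sets included. *)
Definition latent_half (b : bool) : set R :=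
  if b then `[0, 2^-1[%classic else ~` `[0, 2^-1[%classic.

Lemma measurable_latent_half b : measurable (latent_half b).
Proof. by case: b; rewrite /latent_half //; apply: measurableC. Qed.

Lemma latent_halfE b x : latent_half b x -> b = (0 <= x < 2^-1).
Proof.
by case: b => /=; rewrite in_itv /=; [move=> ->|move=> /negP/negPf ->].
Qed.

Lemma uniform01_latent_half (y : {RV P >-> R}) (b : bool) :
  uniform01 y -> P (y @^-1` latent_half b) = (2^-1)%:E.
Proof.
move=> yU.
have left_half : P (y @^-1` `[0, 2^-1[%classic) = (2^-1)%:E.
  have := yU _ (measurable_latent_half true); rewrite /distribution /pushforward => ->.
  rewrite /uniform_prob (eq_integral (cst 1%E)) => [|x].
    rewrite integral_cst //= lebesgue_measure_itv /= lte_fin invr_gt0 ltr0n.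
    by rewrite mul1e sube0.
  move=> /set_mem /=; rewrite in_itv /= => /andP[x0 x2]; rewrite /uniform_pdf x0 subr0 invr1.
  by rewrite (le_trans (ltW x2)) // invf_le1 ?ler1n.
case: b => //=; rewrite preimage_setC probability_setC.
  by rewrite left_half -EFinB; congr EFin; field.
exact: measurable_funPTI (measurable_latent_half true).
Qed.

(** The likelihood is constant on each event fixing which nodes have their latent
    position in the left half, and each such event has probability
    [2 ^- n]. *)
Lemma sampled_step_law (n : nat) (G : T -> sgraph 'I_n)
    (Q : pred (sgraph 'I_n)) :
  sampled_from P (step_graphon p_gt0 p_le1) G ->
  P [set w | Q (G w)] = ((\sum_(A : {set 'I_n})
    \sum_(g | Q g) graph_weight (step_weight p A) g) / 2 ^+ n)%:E.
Proof.
move=> [y [yI yU mG GL]].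
pose B (A : {set 'I_n}) i := latent_half (i \in A).
pose X A := \bigcap_i (y i @^-1` B A i).
have mB A i : measurable (B A i) by exact: measurable_latent_half.
have mX A : measurable (X A).
  apply: fin_bigcap_measurable => [|i _]; first exact: finite_finset.
  exact: measurable_funPTI.
have XA A w : X A w -> forall i, (i \in A) = (0 <= y i w < 2^-1).
  by move=> XAw i; apply: latent_halfE; exact: XAw.
have PX A : P (X A) = (2^-1 ^+ n)%:E.
  rewrite yI // (eq_bigr (fun=> (2^-1)%:E)) => [|i _].
    by rewrite prodEFin prodr_const card_ord.
  exact: uniform01_latent_half.
have PXg A g : P (X A `&` G @^-1` [set g]) =
    (graph_weight (step_weight p A) g / 2 ^+ n)%:E.
  rewrite GL // (eq_integral (cst (graph_weight (step_weight p A) g)%:E)).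
    have -> : (\int[P]_(w in X A) cst (graph_weight (step_weight p A) g)%:E w =
        (graph_weight (step_weight p A) g)%:E * P (X A))%E by rewrite integral_cst.
    by rewrite PX -EFinM exprVn.
  by move=> w /set_mem/XA Aw; rewrite /= (edge_likelihood_step _ _ _ Aw).
pose F (z : {set 'I_n} * sgraph 'I_n) := X z.1 `&` G @^-1` [set z.2].
have -> : [set w | Q (G w)] = \bigcup_(z in [set` [pred z | Q z.2]]) F z.
  apply/seteqP; split=> [w Qw|w [[A g] /= Qg [_ /= -> //]]].
  exists ([set i | 0 <= y i w < 2^-1]%SET, G w) => //; split=> //= i _.
  by rewrite /B inE /latent_half /=; case: ifPn => yw /=; rewrite in_itv //; exact/negP.
rewrite measure_finite_union.
- rewrite /F (eq_bigr (fun z => (graph_weight (step_weight p z.1) z.2 / 2 ^+ n)%:E)).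
    by rewrite sumEFin -mulr_suml pair_big.
  by move=> z _; exact: PXg.
- by move=> z _; apply: measurableI; [exact: mX|exact: mG].
- move=> [A g] [A' g'] _ _ [w [/= [/XA Aw Gg] [/XA A'w Gg']]].
  congr pair; last exact: etrans (esym Gg) Gg'.
  by apply/setP => i; rewrite Aw A'w.
Qed.

End law.

(** * The limit *)

Theorem proposition2 (R : realType) (p : R) (p_gt0 : 0 < p) (p_le1 : p <= 1)
    (d : nat -> measure_display) (T : forall n, measurableType (d n))
    (P : forall n, probability (T n) R)
    (G : forall n, T n -> sgraph 'I_n)
    (G_sampled : forall n, sampled_from (P n) (step_graphon p_gt0 p_le1) (G n)) :
  (fun n => P n [set w | has_hamiltonian_decomposition (directed (G n w))])
    @ \oo --> (2^-1)%:E.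
Proof.
pose h n : R := #|small_subsets n|%:R / 2 ^+ n.
pose C : R := 81 * (4 / p) ^+ 4.
pose a n : R := (\sum_(A : {set 'I_n})
  \sum_(g | hamiltonian g) graph_weight (step_weight p A) g) / 2 ^+ n.
have -> : (fun n => P n [set w | has_hamiltonian_decomposition (directed (G n w))]) =
    EFin \o a.
  apply/funext => n /=; rewrite -(sampled_step_law _ (G_sampled n)).
  congr (P n _); apply/seteqP; split=> w /=.
    move=> /has_hamiltonian_decompositionP[s sG].
    by apply/existsP; exists s; apply/forallP.
  move=> /existsP[s /forallP sG].
  by apply/has_hamiltonian_decompositionP; exists s.
apply: cvg_EFin; first exact: nearW.
have C0 : 0 <= C by rewrite mulr_ge0 ?exprn_ge0 // divr_ge0 ?(ltW p_gt0).
have p01 : 0 <= p <= 1 by rewrite ltW.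
have w_ge0 n (A : {set 'I_n}) g : 0 <= graph_weight (step_weight p A) g.
  by apply/graph_weight_ge0/step_weight_ge0_le1.
have w_sum n (A : {set 'I_n}) : \sum_g graph_weight (step_weight p A) g = 1.
  exact/sum_graph_weight/step_weight_card2.
have hE n : h n = (\sum_(A in small_subsets n) 1) / 2 ^+ n by rewrite sumr_const.
have a_le n : a n <= h n.
  rewrite hE ler_wpM2r ?invr_ge0 ?exprn_ge0 // [leRHS]big_mkcond.
  apply: ler_sum => A _; case: ifPn => [_|]; last first.
    by rewrite inE -ltnNge => nA; rewrite hamiltonian_weight0 ?card_ord.
  by rewrite -[leRHS](w_sum _ A) [leRHS](bigID (@hamiltonian _)) /= lerDl sumr_ge0.
have h_le n : h n - 4 * C / n.+1%:R <= a n.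
  have CN0 : 0 <= 4 * C / n.+1%:R.
    by rewrite divr_ge0 // mulr_ge0.
  (* Both matchings have sides of size at least [n./2]. *)
  have bound_le k : (n./2 <= k)%N -> unmatched_bound (1 - p) k <= 2 * C / n.+1%:R.
    move=> nk; apply: le_trans (unmatched_bound_le _ p_gt0 p_le1) _.
    have -> : 2 * C / n.+1%:R = C / (n.+1%:R / 2) by field; rewrite nat1r pnatr_eq0.
    rewrite -/C ler_wpM2l //.
    rewrite lef_pV2 ?posrE ?divr_gt0 // ler_pdivrMr // -natrM ler_nat; lia.
  have small_le (A : {set 'I_n}) : A \in small_subsets n ->
      1 - 4 * C / n.+1%:R <=
      \sum_(g | hamiltonian g) graph_weight (step_weight p A) g.
    rewrite inE => nA; rewrite lerBlDl -[leLHS](w_sum _ A).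
    rewrite (bigID (@hamiltonian _)) /=.
    rewrite [leRHS]addrC lerD2l.
    have AV : (#|A|.*2 <= #|'I_n|)%N by rewrite card_ord.
    apply: le_trans (nonhamiltonian_weight_le p01 (erefl _) AV) _.
    rewrite card_ord.
    have -> : 4 * C / n.+1%:R = 2 * C / n.+1%:R + 2 * C / n.+1%:R.
      by field; rewrite nat1r pnatr_eq0.
    by apply: lerD; apply: bound_le; lia.
  have h1 : h n <= 1.
    rewrite /h ler_pdivrMr ?exprn_gt0 // mul1r -natrX ler_nat.
    by rewrite (leq_trans (max_card _)) // -cardsT -powersetT card_powerset cardsT card_ord.
  apply: (@le_trans _ _ (h n * (1 - 4 * C / n.+1%:R))).
    by rewrite mulrBr mulr1 lerD2l lerN2 ler_piMl.
  rewrite hE mulrAC ler_wpM2r ?invr_ge0 ?exprn_ge0 //.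
  rewrite mulr_suml [leLHS]big_mkcond; apply: ler_sum => A _.
  by case: ifPn => As; rewrite ?mul1r ?small_le // sumr_ge0.
apply: (@squeeze_cvgr _ _ _ _ (fun n => h n - 4 * C / n.+1%:R) h).
- by apply: nearW => n; rewrite h_le a_le.
- rewrite -[X in _ --> X]subr0; apply: cvgB; first exact: half_subsets_cvg.
  rewrite -(mulr0 (4 * C)); apply: cvgMr; exact: cvg_harmonic.
- exact: half_subsets_cvg.
Qed.
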